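(* Let $A,B\in\mathcal{L}(\mathcal{H})$ have closed ranges and suppose that $A$ is an EP operator. Then $A\overset{*}{\leq}B$ if and only if $(AB)^\dagger=B^\dagger A^\dagger$ and $A=P_AB$.
   Context: $\mathcal{H}$ is a complex Hilbert space, $\mathcal{L}(\mathcal{H})$ is the algebra of bounded linear operators on $\mathcal{H}$, and $\mathcal{R}(T)$, $\mathcal{N}(T)$ denote range and nullspace. $P_A$ is the orthogonal projection onto $\overline{\mathcal{R}(A)}$. An operator $T\in\mathcal{L}(\mathcal{H})$ is EP if $\mathcal{R}(T)$ is closed and $\mathcal{R}(T)=\mathcal{R}(T^* )$. The Moore-Penrose inverse of $T\in\mathcal{L}(\mathcal{H})$ is the (in general densely defined, unbounded) operator $T^\dagger:\mathcal{R}(T)\oplus\mathcal{R}(T)^\perp\to\mathcal{H}$ with $T^\dagger|_{\mathcal{R}(T)}=(T|_{\mathcal{N}(T)^\perp})^{-1}$ (where $T|_{\mathcal{N}(T)^\perp}:\mathcal{N}(T)^\perp\to\mathcal{R}(T)$) and $\mathcal{N}(T^\dagger)=\mathcal{R}(T)^\perp$; $T^\dagger\in\mathcal{L}(\mathcal{H})$ if and only if $\mathcal{R}(T)$ is closed. Star order: $A\overset{*}{\leq}B$ if $A^*A=A^*B$ and $AA^*=BA^*$. *)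

(* Defs.v *)
From HB Require Import structures.
From mathcomp Require Import all_boot all_order all_algebra.
From mathcomp Require Import complex.
From mathcomp Require Import all_classical all_reals all_analysis.

Set Implicit Arguments.
Unset Strict Implicit.
Unset Printing Implicit Defensive.

Import Order.TTheory GRing.Theory Num.Theory.
Import numFieldNormedType.Exports.

Local Open Scope classical_set_scope.
Local Open Scope ring_scope.

(* The library has no Hilbert spaces: one is given here by a complete normed
   module over R[i] and a positive definite Hermitian form [dot] (linear in its
   first argument) which induces the norm. *)
Section HilbertSpace.
Context (R : realType) (H : completeNormedModType R[i]).
Variable dot : {dot H for (@Num.conj R[i])}.
Implicit Types (T S : H -> H) (M : set H).

Definition induces_norm := forall x : H, `|x| ^+ 2 = dot x x.

Definition bounded_operator T := exists C : R[i], forall x, `|T x| <= C * `|x|.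

Definition nullspace T : set H := [set x | T x = 0].

Definition orthocomplement M : set H :=
  [set x | forall m, M m -> dot x m = 0].

(* [adjoint] and [orthogonal_projection] are total functions, with junk value 0
   at points where no vector has the defining property; for bounded T and closed
   subspaces M this never happens (Riesz representation, projection theorem). *)
Definition adjoint T : H -> H :=
  fun y => xget 0 [set z | forall x, dot (T x) y = dot x z].

Definition orthogonal_projection M : H -> H :=
  fun x => xget 0 [set m | M m /\ orthocomplement M (x - m)].

Definition range_projection T : H -> H :=
  orthogonal_projection (closure (range T)).

Definition EP T := closed (range T) /\ range T = range (adjoint T).

Definition star_le T S :=
  adjoint T \o T = adjoint T \o S /\ T \o adjoint T = S \o adjoint T.

(* The Moore-Penrose inverse may be unbounded with a proper domain, so it is
   represented by its graph [set (y, x)]: y = T x + w with x in N(T)^perp and w in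
   R(T)^perp.  Hence its domain is R(T) (+) R(T)^perp, it inverts the restriction
   of T to N(T)^perp on R(T), and its kernel is R(T)^perp.  Equality of graphs
   includes equality of domains, and composition of operators on their natural
   domain is the composition of graphs [_ \; _]. *)
Definition moore_penrose T : set (H * H) :=
  [set p | exists w, [/\ orthocomplement (nullspace T) p.2,
                         orthocomplement (range T) w & p.1 = T p.2 + w]].

End HilbertSpace.

(* Main.v *)
Require Import Defs.
From HB Require Import structures.
From mathcomp Require Import all_boot all_order all_algebra.
From mathcomp Require Import complex ring.
From mathcomp Require Import all_classical all_reals all_analysis.

Set Implicit Arguments.
Unset Strict Implicit.
Unset Printing Implicit Defensive.

Import Order.TTheory GRing.Theory Num.Theory.
Import numFieldNormedType.Exports.

Local Open Scope classical_set_scope.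
Local Open Scope ring_scope.

(** Write M for the range of A and N for its orthogonal complement.  Since A is
    EP, M is closed and N is the nullspace of A, so H is the orthogonal sum of M
    and N, and A is an invertible operator on M extended by 0 on N
    ([EP_nullspace], [EP_split], [EP_inj], [EP_range]).  Everything reduces to
    how B sits with respect to this splitting.

    The equation A^* A = A^* B says that B - A maps into the nullspace N of A^*,
    and so does A = P_A B ([compression_eqP]).  The equation A A^* = B A^* says
    that A and B agree on the range of A^*, which is M.  Hence the star order
    means that B - A maps into N and vanishes on M ([star_leP]), and it remains
    to show, when B - A maps into N, that (AB)^+ = B^+ A^+ holds exactly when
    A = B on M ([reverse_order_lawP]).  In that case AB = AA, since A kills N,
    and (AA)^+ inverts A twice on M.
    - If A = B on M, then for z = A u with u in M we have z = B u, and u is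
      orthogonal to the nullspace of B because that nullspace lies in N; so B^+
      sends z to u, as A^+ does.
    - Conversely, for x in M both products send A (A x) to x, which means
      B^+ (A x) = x, so that w = A x - B x is orthogonal to the range of B.  As
      w also lies in N, it is orthogonal to A x and to B x, hence to itself.

    The splitting of H and the meaning of the adjoint rest on the projection
    theorem ([projection_exists]) and on the Riesz representation theorem
    ([riesz]), both proved here. *)

(** * Infima, small scalars and closures *)

(** Nonnegative elements of R[i] are real, so they have an infimum although the
    order of R[i] is partial. *)
Lemma complex_inf (R : realType) (T : Type) (S : set T) (g : T -> R[i]) :
  S !=set0 -> (forall t, S t -> 0 <= g t) ->
  exists d, (forall t, S t -> d <= g t) /\
    (forall e, 0 < e -> exists2 t, S t & g t < d + e).
Proof.
move=> [t0 St0] g_ge0; pose E := [set complex.Re (g t) | t in S].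
have g_real t : S t -> (complex.Re (g t))%:C%C = g t.
  by move=> St; apply/RRe_real/ger0_real/g_ge0.
have lbE : has_lbound E.
  by exists 0 => _ [t St <-]; rewrite -lecR g_real//; apply: g_ge0.
exists (inf E)%:C%C; split=> [t St|e e_gt0].
  by rewrite -(g_real t St) lecR; apply: ge_inf => //; exists t.
have e_real : (complex.Re e)%:C%C = e by apply/RRe_real/gtr0_real.
have /inf_adherent : 0 < complex.Re e by rewrite -ltcR e_real.
move=> /(_ E) []; first by split=> //; exists (complex.Re (g t0)), t0.
move=> _ [t St <-] lt_t; exists t => //.
by rewrite -(g_real t St) -e_real -rmorphD ltcR.
Qed.

Lemma eq0_of_small (K : numFieldType) (c k : K) :
  0 <= k -> (forall e, 0 < e -> `|c| <= e * k) -> c = 0.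
Proof.
move=> k_ge0 small; apply/eqP; rewrite -normr_eq0; apply: contraT => c_neq0.
have c_gt0 : 0 < `|c| by rewrite lt_def c_neq0 normr_ge0.
have k1_gt0 : 0 < k + 1 by apply: ltr_wpDl.
have := small (`|c| / (k + 1)) (divr_gt0 c_gt0 k1_gt0).
rewrite -mulrA ler_pMr// mulrC ler_pdivlMr// mul1r gerDl.
by rewrite (lt_geF ltr01).
Qed.

Lemma closure_norm (K : numFieldType) (V : normedModType K) (M : set V) x e :
  closure M x -> 0 < e -> exists2 m, M m & `|x - m| < e.
Proof.
move=> Mx e_gt0; have [m [Mm]] := Mx _ (nbhsx_ballx x e e_gt0).
by rewrite -ball_normE; exists m.
Qed.

(** * Inner product identities *)

Section Hilbert.
Context (R : realType) (H : completeNormedModType R[i]).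
Context (dot : {dot H for (@Num.conj R[i])}) (dot_norm : induces_norm dot).
Implicit Types (M : set H) (x y z u v w : H) (a : R[i]).

Definition linear_subspace M :=
  M 0 /\ forall a x y, M x -> M y -> M (a *: x + y).

Lemma dotZl a x y : dot (a *: x) y = a * dot x y.
Proof. exact: linearZl_LR. Qed.

Lemma dotZr a x y : dot x (a *: y) = a^* * dot x y.
Proof. exact: linearZr_LR. Qed.

Lemma dotDl x y z : dot (x + y) z = dot x z + dot y z.
Proof. exact: linearDl. Qed.

Lemma dotBl x y z : dot (x - y) z = dot x z - dot y z.
Proof. exact: linearBl. Qed.

Lemma dotBr x y z : dot x (y - z) = dot x y - dot x z.
Proof. exact: linearBr. Qed.

Lemma dot0l x : dot 0 x = 0.
Proof. exact: linear0l. Qed.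

Lemma dot0r x : dot x 0 = 0.
Proof. exact: linear0r. Qed.

Lemma dotC_eq0 x y : dot x y = 0 -> dot y x = 0.
Proof. by move=> xy0; rewrite (hermC dot) /= xy0 rmorph0 mulr0. Qed.

Lemma dot_self_eq0 x : dot x x = 0 -> x = 0.
Proof. by move/eqP; rewrite dnorm_eq0 => /eqP. Qed.

Lemma eq_of_dot x y : (forall z, dot z x = dot z y) -> x = y.
Proof.
move=> eq_xy; apply/eqP; rewrite -subr_eq0; apply/eqP/dot_self_eq0.
by rewrite dotBr eq_xy subrr.
Qed.

Lemma pythagoras x y : dot x y = 0 -> `|x + y| ^+ 2 = `|x| ^+ 2 + `|y| ^+ 2.
Proof. by move=> xy0; rewrite !dot_norm dnormD xy0 rmorph0 !addr0. Qed.

Lemma parallelogram x y :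
  `|x - y| ^+ 2 = 2 * (`|x| ^+ 2 + `|y| ^+ 2) - `|x + y| ^+ 2.
Proof.
by rewrite !dot_norm dnormB dnormD mulr_natl mulr2n addrKA.
Qed.

(** The vector [a *: y] is the component of x along y. *)
Lemma orthogonal_split x y : exists a, dot (x - a *: y) y = 0.
Proof.
have [->|y_neq0] := eqVneq y 0; first by exists 0; rewrite dot0r.
exists (dot x y / dot y y).
by rewrite dotBl dotZl divfK ?subrr// dnorm_eq0.
Qed.

(** Only the component of x along y contributes to [dot x y], and by Pythagoras
    it is no longer than x. *)
Lemma cauchy_schwarz x y : `|dot x y| <= `|x| * `|y|.
Proof.
have [a ay0] := orthogonal_split x y.
have dotE : dot x y = a * dot y y.
  by rewrite -[x in LHS](subrK (a *: y)) dotDl ay0 add0r dotZl.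
rewrite dotE -dot_norm normrM normrX normr_id expr2 mulrA -normrZ.
rewrite ler_wpM2r// -(@ler_pXn2r _ 2)// ?nnegrE//.
rewrite -[x in leRHS](subrK (a *: y)) pythagoras ?dotZr ?ay0 ?mulr0//.
by rewrite lerDr exprn_ge0.
Qed.

(** * Projection theorem, Riesz representation and adjoints *)

(** With d the infimum of the squared distances from x to points of M, the sets
    of points whose squared distance is less than d + e generate a filter; it is
    Cauchy by the parallelogram identity, and its limit is the projection of x.
    Orthogonality comes from near minimality: if m is nearly minimal and v is in
    M, the component of x - m along v is short, since removing it moves m inside
    M and cannot bring the squared distance below d. *)
Lemma projection_exists M x : linear_subspace M -> closed M ->
  exists2 p, M p & orthocomplement dot M (x - p).
Proof.
move=> [M0 ML] closedM.
have [|m _|d [d_le d_adh]] := @complex_inf R H M (fun m => `|x - m| ^+ 2).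
- by exists 0.
- exact: exprn_ge0.
pose near_min e := [set m | M m /\ `|x - m| ^+ 2 < d + e].
pose F := filter_from [set e | 0 < e] near_min.
have filterF : ProperFilter F.
  apply: filter_from_proper => [|e /= /d_adh[m Mm lt_m]]; last by exists m.
  apply: filter_from_filter; first by exists 1; apply: ltr01.
  move=> e1 e2 /= e1_gt0 e2_gt0.
  have /orP[e12|e21] := real_leVge (gtr0_real e1_gt0) (gtr0_real e2_gt0).
  - exists e1 => // m [Mm lt_m]; split; split=> //.
    by apply: lt_le_trans lt_m _; rewrite lerD2l.
  - exists e2 => // m [Mm lt_m]; split; split=> //.
    by apply: lt_le_trans lt_m _; rewrite lerD2l.
have cauchyF : cauchy F.
  (* Two points within d + r have a midpoint no nearer than d, so the squared
     distance between them is less than 4 r = e^2. *)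
  apply: cauchy_exP => e e_gt0; pose r := (e / 2) ^+ 2.
  have r_gt0 : 0 < r by rewrite exprn_gt0// divr_gt0.
  have [m Mm lt_m] := d_adh r r_gt0; exists m, r => //= m' [Mm' lt_m'].
  rewrite -ball_normE /= -(@ltr_pXn2r _ 2)// ?nnegrE ?(ltW e_gt0)//.
  have -> : m - m' = (x - m') - (x - m) by rewrite opprB [RHS]addrC subrKA.
  rewrite parallelogram.
  have -> : x - m' + (x - m) = 2 *: (x - 2^-1 *: (m' + m)).
    rewrite scalerBr scalerA divff// scale1r scaler_nat mulr2n opprD.
    by rewrite addrACA.
  rewrite normrZ exprMn normr_nat.
  have mid : M (2^-1 *: (m' + m)).
    rewrite -[X in M X]addr0; apply: (ML) => //.
    by rewrite -[m']scale1r; apply: (ML).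
  have dmid := d_le _ mid.
  rewrite ltrBlDr (@lt_le_trans _ _ (2 * ((d + r) + (d + r))))//.
    by rewrite ltr_pM2l// ltrD.
  have -> : 2 * (d + r + (d + r)) = e ^+ 2 + 2 ^+ 2 * d.
    by rewrite /r; field.
  by rewrite lerD2l ler_pM2l ?exprn_gt0.
have cvgF : cvg F by apply/cauchy_cvgP.
have F_near r e : 0 < r -> 0 < e ->
    exists2 m, near_min r m & `|lim F - m| < e.
  move=> r_gt0 e_gt0.
  have Fr : F (near_min r) by exists r.
  have Fb : F (ball (lim F) e) by apply: cvgF; apply: nbhsx_ballx.
  by have [m [] ? ] := filter_ex (filterI Fr Fb); rewrite -ball_normE; exists m.
exists (lim F).
  apply: closedM => U /cvgF FU.
  have FM : F (near_min 1) by exists 1 => //; apply: ltr01.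
  by have [m [[]]] := filter_ex (filterI FM FU); exists m.
move=> v Mv; apply: (@eq0_of_small _ _ (2 * `|v|)); first by rewrite mulr_ge0.
move=> e e_gt0.
have [m [Mm lt_m] pm] := F_near _ _ (exprn_gt0 2 e_gt0) e_gt0.
have [a av0] := orthogonal_split (x - m) v.
have av_lt : `|a *: v| < e.
  rewrite -(@ltr_pXn2r _ 2)// ?nnegrE ?(ltW e_gt0)//.
  rewrite -(ltrD2l d) (le_lt_trans _ lt_m)//.
  rewrite -[x - m](subrK (a *: v)) pythagoras ?dotZr ?av0 ?mulr0// lerD2r.
  by rewrite -addrA -opprD; apply: d_le; rewrite addrC; apply: ML.
have -> : x - lim F = (x - m - a *: v) + (a *: v - (lim F - m)).
  by rewrite addrA subrK opprB addrA subrK.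
rewrite dotDl av0 add0r (le_trans (cauchy_schwarz _ _))// mulrA.
rewrite ler_wpM2r// (le_trans (ler_normB _ _))// mulrC mulr_natl mulr2n.
by rewrite ltW// ltrD.
Qed.

(** A nonzero functional f has a vector w with f w != 0 orthogonal to its kernel.
    Subtracting (f x / f w) w from x gives a vector of the kernel, so f is
    proportional to [dot ^~ w]. *)
Lemma riesz (f : H -> R[i]) :
  (forall a x y, f (a *: x + y) = a * f x + f y) ->
  (exists C, forall x, `|f x| <= C * `|x|) ->
  exists z, forall x, f x = dot x z.
Proof.
move=> fL [C fC].
have fB a x y : f (x - a *: y) = f x - a * f y.
  by rewrite addrC -scaleNr fL mulNr addrC.
have f0 : f 0 = 0 by have := fB 1 0 0; rewrite scale1r subr0 mul1r subrr.
have subspace_ker : linear_subspace [set x | f x = 0].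
  by split=> //= a x y fx0 fy0; rewrite fL fx0 fy0 mulr0 addr0.
have closed_ker : closed [set x | f x = 0].
  move=> x clx; apply: (@eq0_of_small _ _ `|C|) => // e e_gt0.
  have [m /= fm0 xm] := closure_norm clx e_gt0.
  have -> : f x = f (x - m) by rewrite -[m]scale1r fB fm0 mulr0 subr0.
  have C_ge0 : 0 <= C * `|x - m| by apply: le_trans (fC _).
  rewrite (le_trans (fC _))// -(ger0_norm C_ge0) normrM normr_id mulrC.
  by rewrite ler_wpM2r// ltW.
have [fx0|/existsNP[x0 fx0]] := pselect (forall x, f x = 0).
  by exists 0 => x; rewrite fx0 dot0r.
have [p /= fp0] := projection_exists x0 subspace_ker closed_ker.
set w := x0 - p => w_ker.
have fw : f w != 0.
  by rewrite /w -[p]scale1r fB fp0 mulr0 subr0; apply/eqP.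
have w_neq0 : dot w w != 0.
  by rewrite dnorm_eq0; apply: contra_neq fw => ->.
exists ((f w / dot w w)^* *: w) => x; rewrite dotZr conjCK.
have /w_ker/dotC_eq0/eqP : f (x - (f x / f w) *: w) = 0.
  by rewrite fB divfK ?subrr.
rewrite dotBl dotZl subr_eq0 => /eqP ->.
by rewrite mulrACA mulVf// mulr1 mulrC divfK.
Qed.

(** The default value in the definition of [adjoint] is never taken for bounded
    operators. *)
Lemma adjointP (T : {linear H -> H}) : bounded_operator T ->
  forall x y, dot (T x) y = dot x (adjoint dot T y).
Proof.
move=> [C TC] x y.
suff [z Tz] : exists z, forall x, dot (T x) y = dot x z.
  by apply: (@xgetPex _ 0 [set z | forall x, dot (T x) y = dot x z]); exists z.
apply: riesz => [a u v|]; first by rewrite linearP dotDl dotZl.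
exists (C * `|y|) => u; rewrite (le_trans (cauchy_schwarz _ _))// mulrAC.
by rewrite ler_wpM2r.
Qed.

Lemma range_subspace (T : {linear H -> H}) : linear_subspace (range T).
Proof.
split=> [|a _ _ [x _ <-] [y _ <-]]; first by exists 0; rewrite ?linear0.
by exists (a *: x + y); rewrite ?linearP.
Qed.

Lemma orthocomplement_subspace M : linear_subspace (orthocomplement dot M).
Proof.
split=> [m _|a x y xM yM m Mm]; first exact: dot0l.
by rewrite dotDl dotZl xM// yM// mulr0 addr0.
Qed.

Lemma subspaceB M x y : linear_subspace M -> M x -> M y -> M (x - y).
Proof. by move=> [_ ML] Mx My; rewrite addrC -scaleN1r; apply: ML. Qed.

Lemma orthocomplement_disjoint M x : M x -> orthocomplement dot M x -> x = 0.
Proof. by move=> Mx /(_ _ Mx)/dot_self_eq0. Qed.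

Lemma orthogonal_projection_eq M x m : linear_subspace M ->
  M m -> orthocomplement dot M (x - m) -> orthogonal_projection dot M x = m.
Proof.
move=> subM Mm xm; rewrite /orthogonal_projection.
case: xgetP => [p _ [Mp xp]|/(_ m)]; last by case.
apply/eqP; rewrite -subr_eq0; apply/eqP/(@orthocomplement_disjoint M).
  exact: subspaceB.
have -> : p - m = (x - m) - (x - p) by rewrite opprB [RHS]addrC subrKA.
by apply: subspaceB xp => //; apply: orthocomplement_subspace.
Qed.

(** * Structure of EP operators *)

Section EP.
Context (A : {linear H -> H}) (bounded_A : bounded_operator A).
Context (EP_A : EP dot A).
Let M := range A.
Let N := orthocomplement dot M.

Lemma range_adjoint y : M y -> exists z, y = adjoint dot A z.
Proof. by case: EP_A => _; rewrite /M => -> [z _ <-]; exists z. Qed.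

Lemma adjoint_range z : M (adjoint dot A z).
Proof. by case: EP_A => _; rewrite /M => ->; exists z. Qed.

(** In general the nullspace of A is orthogonal to the range of [adjoint dot A];
    for an EP operator that range is M. *)
Lemma EP_nullspace x : A x = 0 <-> N x.
Proof.
split=> [Ax0 y /range_adjoint[z ->]|xN].
  by rewrite -adjointP// Ax0 dot0l.
by apply: dot_self_eq0; rewrite adjointP// xN//; apply: adjoint_range.
Qed.

Lemma EP_split x : exists2 m, M m & N (x - m).
Proof. by apply: projection_exists (range_subspace A) _; case: EP_A. Qed.

(** The biorthogonal complement of the closed subspace M is M itself. *)
Lemma EP_nullspace_perp x : orthocomplement dot (nullspace A) x <-> M x.
Proof.
split=> [xN|Mx n /EP_nullspace nM]; last exact/dotC_eq0/nM.
have [m Mm xm] := EP_split x.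
suff /eqP : x - m = 0 by rewrite subr_eq0 => /eqP ->.
apply: dot_self_eq0; rewrite dotBl xN; last exact/EP_nullspace.
by rewrite (dotC_eq0 (xm _ Mm)) subrr.
Qed.

Lemma EP_inj x y : M x -> M y -> A x = A y -> x = y.
Proof.
move=> Mx My Axy; apply/eqP; rewrite -subr_eq0; apply/eqP.
apply: (@orthocomplement_disjoint M).
  by apply: subspaceB => //; apply: range_subspace.
by apply/EP_nullspace; rewrite linearB Axy subrr.
Qed.

Lemma EP_range y : M y -> exists2 x, M x & y = A x.
Proof.
move=> [x _ <-]; have [m Mm /EP_nullspace xm] := EP_split x.
by exists m => //; apply/eqP; rewrite -subr_eq0 -linearB xm.
Qed.

(** * Moore-Penrose inverses *)

(** For an operator with the nullspace and the range of A, both orthogonality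
    conditions in the graph refer to the splitting of H into M and N. *)
Lemma moore_penrose_sameP (T : H -> H) y x :
  nullspace T = nullspace A -> range T = M ->
  moore_penrose dot T (y, x) <-> M x /\ N (y - T x).
Proof.
move=> nullE rangeE; rewrite /moore_penrose nullE rangeE.
split=> [[w [/= /EP_nullspace_perp Mx wM ->]]|[Mx yN]].
  by rewrite addrC addKr.
exists (y - T x); split=> //=; first exact/EP_nullspace_perp.
by rewrite addrC subrK.
Qed.

Lemma moore_penroseP y x : moore_penrose dot A (y, x) <-> M x /\ N (y - A x).
Proof. exact: moore_penrose_sameP. Qed.

Lemma moore_penrose_sqrP y x :
  moore_penrose dot (A \o A) (y, x) <-> M x /\ N (y - A (A x)).
Proof.
apply: moore_penrose_sameP; apply/seteqP; split.
- move=> u /= AAu.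
  by apply: (@orthocomplement_disjoint M); [exists u|apply/EP_nullspace].
- by move=> u; rewrite /nullspace /= => ->; rewrite linear0.
- by move=> _ [u _ <-]; exists (A u).
- by move=> _ /EP_range[_ [t _ <-] ->]; exists t.
Qed.

(** * Comparison with a second operator *)

Context (B : {linear H -> H}).

(** The nullspace of the adjoint of A is the orthogonal complement of its range. *)
Lemma adjoint_eqP y z : adjoint dot A y = adjoint dot A z <-> N (z - y).
Proof.
split=> [eq_yz _ [x _ <-]|yz].
  by apply: dotC_eq0; rewrite dotBr !adjointP// eq_yz subrr.
apply: eq_of_dot => x; rewrite -!adjointP//; apply/eqP.
by rewrite eq_sym -subr_eq0 -dotBr; apply/eqP/dotC_eq0/yz; exists x.
Qed.

Lemma range_projectionP y z : M z -> range_projection dot A y = z <-> N (y - z).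
Proof.
have [closedM _] := EP_A; have subM := range_subspace A.
rewrite /range_projection -(closure_id _).1//.
move=> Mz; split=> [<-|]; last exact: orthogonal_projection_eq.
have [m Mm ym] := EP_split y.
by rewrite (orthogonal_projection_eq subM Mm ym).
Qed.

Lemma compression_eqP : A = range_projection dot A \o B :> (H -> H) <->
  forall x, N (B x - A x).
Proof.
split=> [PB x|BA]; last first.
  by apply/funext => x; apply/esym/range_projectionP => //; exists x.
by apply/range_projectionP; [exists x | rewrite [RHS](congr1 (@^~ x) PB)].
Qed.

Lemma star_leP : star_le dot A B <->
  (forall x, N (B x - A x)) /\ (forall x, M x -> B x = A x).
Proof.
split=> [[AB BA]|[BA eqM]]; split.
- by move=> x; apply/adjoint_eqP/(congr1 (@^~ x) AB).
- by move=> _ /range_adjoint[z ->]; apply/esym/(congr1 (@^~ z) BA).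
- by apply/funext => x; apply/adjoint_eqP.
- by apply/funext => z; apply/esym/eqM/adjoint_range.
Qed.

(** When B - A maps into N, the product AB is AA, so the left-hand side inverts A
    twice on M.  The reverse order law then compares the inverses of A and of B
    at the points of M. *)
Lemma reverse_order_lawP : (forall x, N (B x - A x)) ->
  moore_penrose dot (A \o B) =
    (moore_penrose dot B \; moore_penrose dot A)%relation <->
  (forall x, M x -> B x = A x).
Proof.
move=> BA.
have ABE : A \o B = A \o A :> (H -> H).
  apply/funext => x /=; apply/eqP; rewrite -subr_eq0 -linearB; apply/eqP.
  exact/EP_nullspace.
rewrite ABE; split=> [rol x Mx|eqM].
  (* The law factors the pair (A (A x), x) through a point z with A z = A (A x),
     and injectivity of A on M forces z = A x. *)
  have : moore_penrose dot (A \o A) (A (A x), x).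
    by apply/moore_penrose_sqrP; rewrite subrr; split=> // m _; apply: dot0l.
  rewrite rol => -[z /= /moore_penroseP[Mz AxAz] [w [/= _ wB zE]]].
  have Axz : A x = z.
    apply: EP_inj => //; first by exists x.
    apply/eqP; rewrite -subr_eq0; apply/eqP/(@orthocomplement_disjoint M) => //.
    by apply: subspaceB; [exact: range_subspace|exists (A x)|exists z].
  have wE : w = A x - B x by rewrite Axz zE addrC addKr.
  suff w0 : w = 0 by apply/esym/eqP; rewrite -subr_eq0 -wE w0.
  apply: dot_self_eq0; rewrite {2}wE dotBr (wB (B x)); last by exists x.
  rewrite subr0 wE -opprB -scaleN1r dotZl BA ?mulr0//.
  by exists x.
(* If B n = 0, then B n - A n = - A n lies in N as well as in M. *)
have NB n : B n = 0 -> N n.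
  move=> Bn; apply/EP_nullspace/(@orthocomplement_disjoint M); first by exists n.
  by move=> m Mm; rewrite -[A n]opprK -scaleN1r dotZl -[- A n]add0r -Bn BA ?mulr0.
apply/seteqP; split=> -[y x].
  move=> /moore_penrose_sqrP[Mx yN]; exists (A x) => /=.
    by apply/moore_penroseP; split=> //; exists x.
  exists 0; split=> /=; last by rewrite eqM ?addr0.
    by move=> n /NB nN; apply/dotC_eq0/nN.
  by move=> m _; apply: dot0l.
move=> [z /= /moore_penroseP[Mz yN] [w [/= xN wB zE]]].
have [u Mu zu] := EP_range Mz.
(* The vector B (x - u) = - w is both in the range of B and orthogonal to it, so
   x - u is in the nullspace of B, to which x and u are both orthogonal. *)
have xu : x = u.
  apply/eqP; rewrite -subr_eq0; apply/eqP/dot_self_eq0.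
  have Bxu : B (x - u) = 0.
    have BxuE : B (x - u) = - w.
      by rewrite linearB (eqM u)// -zu zE opprD addNKr.
    apply: dot_self_eq0.
    by rewrite {1}BxuE -scaleN1r dotZl wB ?mulr0.
  rewrite dotBl xN// sub0r; apply/eqP; rewrite oppr_eq0; apply/eqP.
  exact/dotC_eq0/(NB _ Bxu).
by apply/moore_penrose_sqrP; rewrite xu -zu.
Qed.

End EP.
End Hilbert.

Theorem proposition5p7 (R : realType) (H : completeNormedModType R[i])
    (dot : {dot H for (@Num.conj R[i])}) (dot_norm : induces_norm dot)
    (A B : {linear H -> H})
    (bounded_A : bounded_operator A) (bounded_B : bounded_operator B)
    (closed_A : closed (range A)) (closed_B : closed (range B))
    (EP_A : EP dot A) :
  star_le dot A B <->
  (moore_penrose dot (A \o B) =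
     (moore_penrose dot B \; moore_penrose dot A)%relation /\
   A = range_projection dot A \o B :> (H -> H)).
Proof.
have star := star_leP dot_norm bounded_A EP_A B.
have compression := compression_eqP dot_norm EP_A B.
have rol := @reverse_order_lawP _ _ _ dot_norm _ bounded_A EP_A B.
split=> [/star[BA eqM]|[rolAB /compression BA]].
  by split; [apply/rol|apply/compression].
by apply/star; split=> //; apply/rol.
Qed.
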